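(* Let $K\subseteq\mathbb{R}^n$ be a closed proper convex cone with nonempty interior, $g:[0,\pi]\to\mathbb{R}$ continuous, strictly increasing, and convex on $[0,\pi/2]$, and $\psi(w)=\int_{K_1} g(\rho(w,y))\,d\sigma(y)$ for $w\in\mathcal{S}^{n-1}$. Then $\psi$ has a unique global minimum point on $\mathcal{S}^{n-1}$, and this point is the only local minimum point of $\psi$ outside $-\hat K$.
   Context: $\mathcal{S}^{n-1}$ is the Euclidean unit sphere in $\mathbb{R}^n$, $\sigma$ the normalized uniform measure on it, $\rho(w,y)=\arccos\langle w,y\rangle$ the geodesic distance. For $A\subseteq\mathbb{R}^n$, $A_1=A\cap\mathcal{S}^{n-1}$ and $\hat A=\{x\in\mathbb{R}^n:\langle x,v\rangle\ge 0\ \forall v\in A\}$. A convex cone is proper if it is contained in some closed halfspace through the origin. *)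

(* Defs.v *)
From HB Require Import structures.
From mathcomp Require Import all_boot all_order all_algebra.
From mathcomp Require Import all_classical all_reals all_analysis.
Set Implicit Arguments. Unset Strict Implicit. Unset Printing Implicit Defensive.
Import Order.TTheory GRing.Theory Num.Theory.
Import numFieldNormedType.Exports.
Local Open Scope classical_set_scope.
Local Open Scope ring_scope.

Definition dotv (R : realType) (n : nat) (x y : 'rV[R]_n) : R :=
  \sum_(i < n) x ord0 i * y ord0 i.

Definition sphere (R : realType) (n : nat) : set 'rV[R]_n :=
  [set x | dotv x x = 1].
Arguments sphere R n : clear implicits.

Definition rho (R : realType) (n : nat) (w y : 'rV[R]_n) : R := acos (dotv w y).

Definition sph_part (R : realType) (n : nat) (A : set 'rV[R]_n) : set 'rV[R]_n :=
  A `&` sphere R n.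

Definition dual_cone (R : realType) (n : nat) (A : set 'rV[R]_n) : set 'rV[R]_n :=
  [set x | forall v, A v -> 0 <= dotv x v].

Definition convex_cone (R : realType) (n : nat) (K : set 'rV[R]_n) : Prop :=
  forall x y (a b : R), K x -> K y -> 0 <= a -> 0 <= b -> K (a *: x + b *: y).

Definition proper_cone (R : realType) (n : nat) (K : set 'rV[R]_n) : Prop :=
  exists v : 'rV[R]_n, v != 0 /\ forall x, K x -> 0 <= dotv x v.

Definition Rn_borel (R : realType) (n : nat) :=
  g_sigma_algebraType (@open 'rV[R]_n).
Arguments Rn_borel R n : clear implicits.

Definition orthogonal_mx (R : realType) (n : nat) (Q : 'M[R]_n) : Prop :=
  Q *m Q^T = 1%:M.

(* sigma is the normalized uniform measure on S^{n-1}: the (unique)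
   Borel probability measure concentrated on the sphere and invariant
   under all orthogonal transformations. *)
Definition uniform_sphere_measure (R : realType) (n : nat)
  (sigma : probability (Rn_borel R n) R) : Prop :=
  sigma (~` (sphere R n : set (Rn_borel R n))) = 0%E /\
  forall (Q : 'M[R]_n) (A : set (Rn_borel R n)), orthogonal_mx Q ->
    measurable A ->
    sigma ((fun x : Rn_borel R n => (x *m Q : 'rV[R]_n) : Rn_borel R n) @^-1` A)
    = sigma A.

Definition psi (R : realType) (n : nat) (sigma : probability (Rn_borel R n) R)
  (K : set 'rV[R]_n) (g : R -> R) (w : 'rV[R]_n) : \bar R :=
  (\int[sigma]_(y in (sph_part K : set (Rn_borel R n))) (g (rho w y))%:E)%E.

(* Main.v *)
Require Import Defs.
From HB Require Import structures.
From mathcomp Require Import all_boot all_order all_algebra.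
From mathcomp Require Import all_classical all_reals all_analysis.
From mathcomp Require Import measurable_realfun ring lra.
Set Implicit Arguments.
Unset Strict Implicit.
Unset Printing Implicit Defensive.
Import Order.TTheory GRing.Theory Num.Theory.
Import numFieldNormedType.Exports.
Local Open Scope classical_set_scope.
Local Open Scope ring_scope.

(**
Three moves decrease [psi] strictly.
- Reflection: if [z] is interior to [K], [<w, z> < 0] and [s] is the reflection
  in the hyperplane orthogonal to [z], then [2 (psi w - psi (s w))] is the
  integral of [(1_K y - 1_K (s y)) (g (rho w y) - g (rho (s w) y))], whose two
  factors always have the same sign because [K + z] lies in [K]. Choosing [z]
  almost orthogonal to [w] makes the move small, so a local minimum point
  outside [- K^] lies in [K^]; a large move shows that a global minimum point is
  not in [- K^].
- Projection: if [w] is in [K^] but not in [K], moving [w] slightly towards its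
  projection on [K] brings it closer to every interior point of [K].
- Midpoint: for distinct [a], [b] in both [K] and [K^], spherical convexity of
  the distance on the hemisphere around [y] and convexity of [g] on
  [[0, pi / 2]] give [psi m < (psi a + psi b) / 2] at the midpoint [m]; the
  inequality is strict because the integrand is strict near [y = m], which is in
  [K].
Hence local minimum points outside [- K^] lie in [K] and [K^], and halving the
arc from one of them to a global minimum point shows that they coincide.
Existence is compactness of the sphere.
*)

(** * Euclidean geometry of row vectors *)

Section dot_product.
Context {R : realType} {n : nat}.
Implicit Types (x y z w v : 'rV[R]_n) (a b c : R).

Lemma dotvC x y : dotv x y = dotv y x.
Proof. by apply: eq_bigr => i _; rewrite mulrC. Qed.

Lemma dotvDl x y z : dotv (x + y) z = dotv x z + dotv y z.
Proof. by rewrite /dotv -big_split/=; apply: eq_bigr => i _; rewrite mxE mulrDl. Qed.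

Lemma dotvZl a x y : dotv (a *: x) y = a * dotv x y.
Proof. by rewrite /dotv mulr_sumr; apply: eq_bigr => i _; rewrite mxE mulrA. Qed.

Lemma dotvDr x y z : dotv z (x + y) = dotv z x + dotv z y.
Proof. by rewrite dotvC dotvDl !(dotvC z). Qed.

Lemma dotvZr a x y : dotv x (a *: y) = a * dotv x y.
Proof. by rewrite dotvC dotvZl dotvC. Qed.

Lemma dotvNl x y : dotv (- x) y = - dotv x y.
Proof. by rewrite -scaleN1r dotvZl mulN1r. Qed.

Lemma dotvNr x y : dotv x (- y) = - dotv x y.
Proof. by rewrite dotvC dotvNl dotvC. Qed.

Definition dotvE := (dotvDl, dotvDr, dotvNl, dotvNr, dotvZl, dotvZr).

Lemma dotvv_ge0 x : 0 <= dotv x x.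
Proof. by apply: sumr_ge0 => i _; rewrite -expr2 sqr_ge0. Qed.

Lemma dotvv_eq0 x : (dotv x x == 0) = (x == 0).
Proof.
apply/idP/eqP => [|->]; last by rewrite -(scale0r (0 : 'rV_n)) dotvZl mul0r.
rewrite psumr_eq0; last by move=> i _; rewrite -expr2 sqr_ge0.
move=> /allP x0; apply/rowP => i; rewrite mxE; apply/eqP.
by have := x0 i (mem_index_enum _); rewrite /= mulf_eq0 orbb.
Qed.

Lemma dotvv_gt0 x : (0 < dotv x x) = (x != 0).
Proof. by rewrite lt0r dotvv_ge0 andbT dotvv_eq0. Qed.

Lemma dotv_cauchy_schwarz x y : dotv x y ^+ 2 <= dotv x x * dotv y y.
Proof.
have [->|y0] := eqVneq y 0.
  by rewrite -(scale0r (0 : 'rV_n)) !dotvZr !mul0r mulr0 expr0n.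
have yy : 0 < dotv y y by rewrite dotvv_gt0.
(* This squared length equals [dotv y y] times the gap between the two sides. *)
have := dotvv_ge0 (dotv y y *: x - dotv x y *: y).
rewrite !dotvE (dotvC y x) => H.
have : 0 <= dotv y y * (dotv x x * dotv y y - dotv x y ^+ 2) by nra.
by rewrite pmulr_rge0// subr_ge0.
Qed.

Lemma dotv_sphere_bound x y : sphere R n x -> sphere R n y -> -1 <= dotv x y <= 1.
Proof.
rewrite /sphere/= => x1 y1.
have := dotv_cauchy_schwarz x y; rewrite x1 y1 mulr1 => H.
by rewrite -ler_norml -(@ler_pXn2r _ 2)// ?nnegrE// expr1n real_normK ?num_real.
Qed.

Lemma sphere_neq0 x : sphere R n x -> x != 0.
Proof. by rewrite /sphere/= -dotvv_gt0 => ->. Qed.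

Lemma sphere_inj x y : sphere R n x -> sphere R n y -> 1 <= dotv x y -> x = y.
Proof.
rewrite /sphere/= => x1 y1 xy; apply/eqP; rewrite -subr_eq0 -dotvv_eq0.
by rewrite eq_le dotvv_ge0 andbT !dotvE x1 y1 (dotvC y); lra.
Qed.

Lemma coord_sqr_le_dotv x i : x ord0 i ^+ 2 <= dotv x x.
Proof.
rewrite /dotv (bigD1 i)//= -expr2 lerDl.
by apply: sumr_ge0 => j _; rewrite -expr2 sqr_ge0.
Qed.

(** Neighbourhoods and boundedness of row vectors refer to the maximum norm; this lemma carries
    Euclidean estimates over to it, coordinate by coordinate. *)
Lemma mx_norm_le_dotv x c : 0 <= c -> dotv x x <= c ^+ 2 -> `|x| <= c.
Proof.
move=> c0 xc; rewrite [leLHS]/Num.norm/= mx_normrE; apply/bigmax_leP; split=> //.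
move=> [i j] _ /=; rewrite (ord1 i).
rewrite -(@ler_pXn2r _ 2)// ?nnegrE// real_normK ?num_real//.
exact: le_trans (coord_sqr_le_dotv x j) xc.
Qed.

(** * Normalization and reflections *)

Definition normalize x : 'rV[R]_n := (Num.sqrt (dotv x x))^-1 *: x.

Lemma normalize_sphere x : x != 0 -> sphere R n (normalize x).
Proof.
move=> x0; rewrite /sphere/= /normalize !dotvE.
have x1 : 0 < dotv x x by rewrite dotvv_gt0.
rewrite mulrA -invfM -expr2 sqr_sqrtr ?mulVf//; first by rewrite gt_eqF.
exact: ltW.
Qed.

Lemma normalize_id x : sphere R n x -> normalize x = x.
Proof. by rewrite /sphere/= /normalize => ->; rewrite sqrtr1 invr1 scale1r. Qed.

(** The invariance of [sigma] is stated for orthogonal matrices, hence this matrix form of the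
    reflection [reflectv z]. *)
Definition reflect_mx z : 'M[R]_n := 1%:M - (2 / dotv z z) *: (z^T *m z).

Definition reflectv z x : 'rV[R]_n := x - (2 * dotv x z / dotv z z) *: z.

Lemma mulmx_reflect_mx z x : x *m reflect_mx z = reflectv z x.
Proof.
rewrite /reflect_mx mulmxBr mulmx1 -scalemxAr mulmxA; congr (_ - _).
have -> : x *m z^T = (dotv x z)%:M.
  apply/rowP => i; rewrite !ord1 !mxE/= mulr1n.
  by apply: eq_bigr => j _; rewrite mxE.
by rewrite mul_scalar_mx scalerA; congr (_ *: _); ring.
Qed.

Lemma reflectvK z : involutive (reflectv z).
Proof.
move=> x; have [->|z0] := eqVneq z 0; first by rewrite /reflectv !scaler0 !subr0.
rewrite /reflectv !dotvE -addrA -opprD -scalerDl.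
have zz : dotv z z != 0 by rewrite dotvv_eq0.
set c := (X in X *: z); have -> : c = 0 by rewrite /c; field.
by rewrite scale0r subr0.
Qed.

Lemma reflectv_adj z x y : dotv (reflectv z x) y = dotv x (reflectv z y).
Proof. by rewrite /reflectv !dotvE (dotvC y) (dotvC z y); ring. Qed.

Lemma reflectv_sphere z x : sphere R n (reflectv z x) <-> sphere R n x.
Proof. by rewrite /sphere/= reflectv_adj reflectvK. Qed.

Lemma reflect_mx_orthogonal z : orthogonal_mx (reflect_mx z).
Proof.
rewrite /orthogonal_mx; have -> : (reflect_mx z)^T = reflect_mx z.
  by rewrite /reflect_mx linearB/= trmx1 linearZ/= trmx_mul trmxK.
apply/row_matrixP => i.
by rewrite !rowE mulmxA !mulmx_reflect_mx reflectvK mulmx1.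
Qed.

(** On the sphere [dotv (x - y) (x - y)] equals [2 * dotv x (x - y)], so the coefficient of the
    reflection is 1. Thus reflections act transitively on the sphere. *)
Lemma reflectv_sub x y : sphere R n x -> sphere R n y -> reflectv (x - y) x = y.
Proof.
move=> sx sy; have [->|xy] := eqVneq x y.
  by rewrite subrr /reflectv scaler0 subr0.
have : dotv (x - y) (x - y) != 0 by rewrite dotvv_eq0 subr_eq0.
rewrite /reflectv; move: sx sy; rewrite /sphere/= !dotvE => -> ->.
rewrite (dotvC y x) => H.
set c := (X in X *: _); have -> : c = 1.
  rewrite /c; field.
  by move: H; apply: contra => /eqP; lra.
by rewrite scale1r opprB addrCA subrr addr0.
Qed.

(** * Continuity, and compactness of the sphere *)

Lemma dotv_continuous2 : continuous (fun xy : 'rV[R]_n * 'rV[R]_n => dotv xy.1 xy.2).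
Proof.
apply: continuous_big => [|i _ xy]; first exact: add_continuous.
apply: cvgM.
  exact: (@cvg_comp _ _ _ fst (fun x : 'rV[R]_n => x ord0 i) _ _ _ cvg_fst
    (@coord_continuous R 1 n ord0 i xy.1)).
exact: (@cvg_comp _ _ _ snd (fun x : 'rV[R]_n => x ord0 i) _ _ _ cvg_snd
  (@coord_continuous R 1 n ord0 i xy.2)).
Qed.

Lemma cvg_dotv (T : Type) (F : set_system T) (f g : T -> 'rV[R]_n) x y :
  Filter F -> f @ F --> x -> g @ F --> y -> dotv (f t) (g t) @[t --> F] --> dotv x y.
Proof.
move=> FF fx gy.
exact: (@cvg_comp _ _ _ (fun t => (f t, g t))
  (fun p : 'rV[R]_n * 'rV[R]_n => dotv p.1 p.2) _ _ _
  (cvg_pair fx gy) (@dotv_continuous2 (x, y))).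
Qed.

Lemma dotvl_continuous w : continuous (dotv w).
Proof. move=> x; exact: (@cvg_dotv _ (nbhs x) (fun=> w) id w x _ (cvg_cst w) cvg_id). Qed.

Lemma dotvv_continuous : continuous (fun x => dotv x x).
Proof. move=> x; exact: (@cvg_dotv _ (nbhs x) id id x x _ cvg_id cvg_id). Qed.

Lemma cvg_reflectv (T : Type) (F : set_system T) (f : T -> 'rV[R]_n) z x :
  Filter F -> f @ F --> x -> reflectv z (f t) @[t --> F] --> reflectv z x.
Proof.
move=> FF fx; rewrite /reflectv; apply: cvgB => //; apply: cvgZr_tmp.
apply: cvgMr_tmp; apply: cvgMl_tmp.
exact: (@cvg_dotv _ F f (fun=> z) x z _ fx (cvg_cst z)).
Qed.

Lemma reflectv_continuous z : continuous (reflectv z).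
Proof. by move=> x; exact: (@cvg_reflectv _ (nbhs x) id z x _ cvg_id). Qed.

(** The reflection along [z] fixes every [w] orthogonal to [z], so reflections along vectors close
    to [z] move [w] only slightly. *)
Lemma cvg_reflectv0 (T : Type) (F : set_system T) (f : T -> 'rV[R]_n) w z :
  Filter F -> z != 0 -> dotv w z = 0 -> f @ F --> z -> reflectv (f t) w @[t --> F] --> w.
Proof.
move=> FF z0 wz fz.
suff : reflectv (f t) w @[t --> F] --> reflectv z w.
  by rewrite {2}/reflectv wz mulr0 mul0r scale0r subr0.
rewrite /reflectv; apply: cvgB; first exact: cvg_cst.
apply: cvgZ => //; apply: cvgM.
  by apply: cvgMl_tmp; exact: (@cvg_dotv _ F (fun=> w) f w z _ (cvg_cst w) fz).
by apply: cvgV; [rewrite dotvv_eq0|exact: (cvg_dotv _ fz fz)].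
Qed.

Lemma cvg_normalize (T : Type) (F : set_system T) (f : T -> 'rV[R]_n) x :
  Filter F -> sphere R n x -> f @ F --> x -> normalize (f t) @[t --> F] --> x.
Proof.
move=> FF sx fx; rewrite -[X in _ --> X](normalize_id sx) /normalize.
apply: cvgZ => //; apply: cvgV; first by rewrite sx sqrtr1 oner_eq0.
by apply: (cvg_comp _ _ (cvg_dotv FF fx fx)); exact: sqrt_continuous.
Qed.

Lemma closed_sphere : closed (sphere R n).
Proof.
rewrite [sphere R n](_ : _ = (fun x => dotv x x) @^-1` [set 1])//.
by apply: closed_comp; [move=> x _; exact: dotvv_continuous|exact: closed_eq].
Qed.

Lemma compact_sphere : compact (sphere R n).
Proof.
apply: bounded_closed_compact; last exact: closed_sphere.
exists 1; split=> // c c1 x sx; apply: mx_norm_le_dotv; first lra.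
by rewrite sx; nra.
Qed.

End dot_product.

(** * Integration against the uniform measure *)

Section uniform_integral.
Context {R : realType} {n : nat}.
Implicit Types (x y z w v p q : 'rV[R]_n) (U : set 'rV[R]_n).

Lemma open_Rn_measurable U : open U -> measurable (U : set (Rn_borel R n)).
Proof. exact: sub_sigma_algebra. Qed.

Lemma closed_Rn_measurable U : closed U -> measurable (U : set (Rn_borel R n)).
Proof.
move=> cU; rewrite -[U]setCK; apply: measurableC.
by apply: open_Rn_measurable; exact: closed_openC.
Qed.

Lemma continuous_Rn_measurable (f : 'rV[R]_n -> R) :
  continuous f -> measurable_fun [set: Rn_borel R n] (f : Rn_borel R n -> R).
Proof.
move=> /continuousP cf; apply: (measurability _ (RGenOpens.measurableE R)).
move=> _ [_ [a [b ->]] <-]; rewrite setTI.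
by apply: open_Rn_measurable; apply: cf; exact: interval_open.
Qed.

Lemma reflectv_measurable z :
  measurable_fun [set: Rn_borel R n] (reflectv z : Rn_borel R n -> Rn_borel R n).
Proof.
apply: (@measurability _ _ (Rn_borel R n) (Rn_borel R n) setT (reflectv z)
  (@open 'rV[R]_n)) => //.
move=> _ [U oU <-]; rewrite setTI; apply: open_Rn_measurable.
by move/continuousP: (@reflectv_continuous R n z); exact.
Qed.

Definition bounded_measurable (f : 'rV[R]_n -> R) : Prop :=
  measurable_fun [set: Rn_borel R n] (f : Rn_borel R n -> R) /\
  exists M : R, forall y, `|f y| <= M.

Lemma bounded_measurableB f g : bounded_measurable f -> bounded_measurable g ->
  bounded_measurable (fun y => f y - g y).
Proof.
move=> [mf [M fM]] [mg [N gN]]; split; first exact: measurable_funB.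
exists (M + N) => y; rewrite (le_trans (ler_normB _ _))//.
by rewrite lerD.
Qed.

Lemma bounded_measurableM f g : bounded_measurable f -> bounded_measurable g ->
  bounded_measurable (fun y => f y * g y).
Proof.
move=> [mf [M fM]] [mg [N gN]]; split; first exact: measurable_funM.
by exists (M * N) => y; rewrite normrM ler_pM.
Qed.

Lemma bounded_measurable_reflectv f z : bounded_measurable f ->
  bounded_measurable (fun y => f (reflectv z y)).
Proof.
move=> [mf [M fM]]; split; last by exists M.
exact: (measurableT_comp mf (reflectv_measurable z)).
Qed.

Lemma bounded_measurable_indic (K : set 'rV[R]_n) : closed K ->
  bounded_measurable \1_K.
Proof.
move=> cK; split.
  by apply: (@measurable_indic _ (Rn_borel R n)); exact: closed_Rn_measurable.
by exists 1 => y; rewrite indicE; case: (_ \in _); rewrite ?normr1 ?normr0.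
Qed.

Variable sigma : probability (Rn_borel R n) R.
Hypothesis usigma : uniform_sphere_measure sigma.

Local Notation S := (sphere R n : set (Rn_borel R n)).

Let mS : measurable S.
Proof. exact: (closed_Rn_measurable (@closed_sphere R n)). Qed.

Lemma uniform_reflectv z (A : set (Rn_borel R n)) : measurable A ->
  sigma ((reflectv z : Rn_borel R n -> Rn_borel R n) @^-1` A) = sigma A.
Proof.
move=> mA; rewrite -(usigma.2 _ _ (reflect_mx_orthogonal z) mA).
by congr (sigma _); apply/seteqP; split=> x /=; rewrite mulmx_reflect_mx.
Qed.

(** If [U] were null, so would be its images under reflections. These images cover the sphere, and
    by compactness finitely many suffice, so the sphere itself would be null. *)
Lemma uniform_open_neq0 U p : open U -> U p -> sphere R n p ->
  sigma (U : set (Rn_borel R n)) != 0%E.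
Proof.
move=> oU Up sp; apply/eqP => U0.
have := @compact_sphere R n; rewrite compact_cover.
(* The reflection along [q - p] sends [q] to [p], so the open set indexed by [q] contains [q]. *)
move=> /(_ _ (sphere R n) (fun q => reflectv (q - p) @^-1` U))[|q sq|D Dsub Dcov].
- by move=> q _; move/continuousP: (@reflectv_continuous R n (q - p)); exact.
- by exists q => //=; rewrite reflectv_sub.
have : sigma.-negligible S.
  apply: (@negligibleS _ (Rn_borel R n) R sigma _ _ Dcov); rewrite /cover bigcup_fset.
  apply: big_ind => [|A B|q _]; [exact: negligible_set0|exact: negligibleU|].
  apply/negligibleP; last exact: (etrans (uniform_reflectv _ (open_Rn_measurable oU)) U0).
  rewrite -[X in measurable X]setTI; apply: reflectv_measurable => //.
  exact: open_Rn_measurable.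
move/(negligibleP sigma mS) => S0.
have := probability_setC sigma mS; rewrite S0 usigma.1 sube0.
by move/eqP; rewrite eq_sym onee_eq0.
Qed.

Lemma bounded_measurable_integrable f : bounded_measurable f ->
  sigma.-integrable S (EFin \o f).
Proof.
move=> [mf [M fM]]; apply: measurable_bounded_integrable => //.
- by rewrite (le_lt_trans (probability_le1 sigma mS))// ltry.
- exact: measurable_funTS.
- by exists M; split; [exact: num_real|move=> c /ltW Mc y _; exact: le_trans Mc].
Qed.

Lemma Rintegral_reflectv f z : bounded_measurable f ->
  \int[sigma]_(y in S) f (reflectv z y) = \int[sigma]_(y in S) f y.
Proof.
move=> bf; rewrite /Rintegral; congr fine.
have SS : (reflectv z : Rn_borel R n -> Rn_borel R n) @^-1` S = S.
  by apply/seteqP; split=> y /=; rewrite -/(sphere R n _) => /reflectv_sphere.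
have mz := reflectv_measurable z.
have mf : measurable_fun [set: Rn_borel R n] (EFin \o f : Rn_borel R n -> \bar R).
  by apply/measurable_EFinP; case: bf.
have /= := @integral_pushforward _ _ _ _ R _ mz sigma S _ mf _ mS.
rewrite SS => <-; last first.
  by apply: bounded_measurable_integrable; exact: bounded_measurable_reflectv.
by apply: eq_measure_integral => A mA _; exact: uniform_reflectv.
Qed.

(** A nonnegative function with zero integral vanishes almost everywhere on the sphere, which would
    make [U] null. *)
Lemma Rintegral_sphere_gt0 f U p : bounded_measurable f ->
  (forall y, sphere R n y -> 0 <= f y) ->
  open U -> U p -> sphere R n p ->
  (forall y, sphere R n y -> U y -> 0 < f y) ->
  0 < \int[sigma]_(y in S) f y.
Proof.
move=> bf f0 oU Up sp fU.
have intf := bounded_measurable_integrable bf.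
rewrite lt0r Rintegral_ge0// andbT; apply/negP => /eqP If0.
have /ae_eq_integral_abs : (\int[sigma]_(x in S) `|(EFin \o f) x| = 0)%E.
  rewrite -[RHS]/(0%:E) -If0 /Rintegral fineK; last exact: integrable_fin_num.
  by apply: eq_integral => y /[!inE] sy /=; rewrite ger0_norm// f0.
move=> /(_ mS)[|N [mN N0 SN]].
  by apply/measurable_EFinP; apply: measurable_funTS; case: bf.
have /negP := uniform_open_neq0 oU Up sp; apply.
have mU := open_Rn_measurable oU.
have : sigma.-negligible (N `|` ~` S).
  apply: negligibleU; apply/negligibleP => //; first exact: measurableC.
  by case: usigma.
move=> nN; apply/eqP/(negligibleP sigma mU); apply: negligibleS nN => y Uy.
have [sy|] := pselect (sphere R n y); last by right.
left; apply: SN => /= /(_ sy)[fy0].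
by have := fU _ sy Uy; rewrite fy0 ltxx.
Qed.

End uniform_integral.

(** * The profile of the integrand *)

Section clamp.
Context {R : realType}.
Implicit Types (a b x : R).

Definition clamp a b x := Num.max a (Num.min b x).

Lemma clamp_in a b x : a <= b -> clamp a b x \in `[a, b].
Proof. by move=> ab; rewrite in_itv/= /clamp le_max lexx/= ge_max ab ge_min lexx. Qed.

Lemma clamp_id a b x : x \in `[a, b] -> clamp a b x = x.
Proof.
by rewrite in_itv/= /clamp => /andP[ax xb]; rewrite (min_idPr xb) (max_idPr ax).
Qed.

Lemma clamp_le a b : {homo clamp a b : x y / x <= y}.
Proof.
move=> x y xy; rewrite /clamp ge_max le_max lexx/= le_max.
by rewrite le_min !ge_min lexx xy !orbT.
Qed.

(** Precomposing with [clamp] turns continuity within the segment into continuity on the whole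
    line. *)
Lemma continuous_clamp_comp a b (f : R -> R) : a <= b ->
  {within `[a, b], continuous f} -> continuous (fun x => f (clamp a b x)).
Proof.
move=> ab cf x.
have cx : clamp a b x \in `[a, b] by exact: clamp_in.
have /cvgrPdist_lt fx := (subspace_continuousP _ _).1 cf _ cx.
apply/cvgrPdist_lt => e /fx; rewrite near_withinE => fe.
have cclamp : clamp a b y @[y --> x] --> clamp a b x.
  apply: (@continuous_max _ _ (cst a) (Num.min b)); first exact: cvg_cst.
  by apply: (@continuous_min _ _ (cst b) id); [exact: cvg_cst|exact: cvg_id].
have := cclamp _ fe; rewrite /= !near_simpl => fe'.
by near=> y; apply: (near fe' y) => //; exact: clamp_in.
Unshelve. all: by end_near.
Qed.

End clamp.

Section profile.
Context {R : realType}.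
Variable g : R -> R.

Lemma within_continuous_acos : {within `[(-1 : R), 1], continuous (@acos R)}.
Proof.
have := @segment_can_ge_continuous R 0 pi cos acos (pi_ge0 R).
rewrite cos0 cospi; apply; last exact: cosK.
by apply: continuous_subspaceT; exact: continuous_cos.
Qed.

(* Clamping makes the profile [g \o acos] continuous and monotone on the whole
   line without changing it on [[-1, 1]], where the inner products live. *)
Definition profile (c : R) : R := g (acos (clamp (-1) 1 c)).

Let m11 : (-1 : R) <= 1. Proof. by lra. Qed.

Lemma profileE c : -1 <= c <= 1 -> profile c = g (acos c).
Proof. by move=> c1; rewrite /profile clamp_id// in_itv. Qed.

Let acos_clamp_in (c : R) : acos (clamp (-1) 1 c) \in `[0, pi].
Proof.
have := clamp_in c m11; rewrite !in_itv/= => c1.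
by rewrite acos_ge0 ?acos_lepi.
Qed.

Hypothesis gcont : {within `[0, pi], continuous g}.

Lemma profile_continuous : continuous profile.
Proof.
move=> c.
suff : g (clamp 0 pi (acos (clamp (-1) 1 t))) @[t --> c] --> profile c.
  by under eq_fun do rewrite clamp_id//.
have -> : profile c = g (clamp 0 pi (acos (clamp (-1) 1 c))).
  by rewrite [in RHS]clamp_id.
apply: (@continuous_comp _ _ _ (fun t => acos (clamp (-1) 1 t))
  (fun t => g (clamp 0 pi t))).
  exact: (continuous_clamp_comp m11 within_continuous_acos).
exact: (continuous_clamp_comp (pi_ge0 R) gcont).
Qed.

Hypothesis ginc : {in `[0, pi] &, forall x y, x < y -> g x < g y}.

Lemma g_le : {in `[0, pi] &, {homo g : x y / x <= y}}.
Proof.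
move=> x y x0 y0; rewrite le_eqVlt => /predU1P[->//|xy].
by apply: ltW; exact: ginc.
Qed.

Lemma acos_lt (x y : R) : -1 <= x -> y <= 1 -> x < y -> acos y < acos x.
Proof.
move=> x1 y1 xy; rewrite -ltr_cos ?in_itv/= ?acos_ge0 ?acos_lepi//; try lra.
by rewrite !acosK// in_itv/=; lra.
Qed.

Lemma profile_lt x y : -1 <= x -> y <= 1 -> x < y -> profile y < profile x.
Proof.
move=> x1 y1 xy; rewrite !profileE; try lra.
apply: ginc; rewrite ?in_itv/= ?acos_ge0 ?acos_lepi//; try lra.
exact: acos_lt.
Qed.

Lemma profile_le x y : x <= y -> profile y <= profile x.
Proof.
move=> /(clamp_le (-1) 1); rewrite le_eqVlt => /predU1P[xy|xy].
  by rewrite /profile xy.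
have := clamp_in x m11; have := clamp_in y m11; rewrite !in_itv/=.
move=> /andP[_ y1] /andP[x1 _].
by apply: g_le => //; apply: ltW; exact: acos_lt.
Qed.

(** By monotonicity all values lie between [g 0] and [g pi]. *)
Lemma profile_bounded : exists M : R, forall c, `|profile c| <= M.
Proof.
exists (Num.max (g pi) (- g 0)) => c; have := acos_clamp_in c.
rewrite in_itv/= => /andP[c0 cpi].
rewrite ler_norml lerNl; apply/andP; split; rewrite le_max; apply/orP; [right|left].
  by rewrite lerN2; apply: g_le => //; rewrite in_itv/= lexx pi_ge0.
by apply: g_le => //; rewrite in_itv/= lexx pi_ge0.
Qed.

Hypothesis gconv : forall x y t, x \in `[0, pi / 2] -> y \in `[0, pi / 2] ->
  t \in `[0, 1] -> g (t * x + (1 - t) * y) <= t * g x + (1 - t) * g y.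

(* With [x = cos al] and [y = cos be], sum-to-product gives
   [x + y = 2 cos ((al + be) / 2) cos ((al - be) / 2)], and the
   hypothesis on [d ^+ 2] says [d <= 2 cos ((al - be) / 2)]. *)
Lemma profile_midpoint x y d : 0 <= x <= 1 -> 0 <= y <= 1 -> 0 < d ->
  d ^+ 2 <= 2 + 2 * (x * y + Num.sqrt (1 - x ^+ 2) * Num.sqrt (1 - y ^+ 2)) ->
  x + y <= d ->
  profile ((x + y) / d) <= (profile x + profile y) / 2.
Proof.
move=> x01 y01 d0 dxy xyd.
have x1 : -1 <= x <= 1 by lra.
have y1 : -1 <= y <= 1 by lra.
set al := acos x; set be := acos y.
have al0 : 0 <= al <= pi / 2.
  rewrite acos_ge0//= -acos0 leNgt; apply/negP => H.
  have : x < 0; last lra.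
  rewrite -[x]acosK ?in_itv//= -[ltRHS]cos_pihalf ltr_cos ?in_itv/=.
  - by rewrite -acos0.
  - by have := pi_ge0 R; lra.
  - by rewrite acos_ge0 ?acos_lepi.
have be0 : 0 <= be <= pi / 2.
  rewrite acos_ge0//= -acos0 leNgt; apply/negP => H.
  have : y < 0; last lra.
  rewrite -[y]acosK ?in_itv//= -[ltRHS]cos_pihalf ltr_cos ?in_itv/=.
  - by rewrite -acos0.
  - by have := pi_ge0 R; lra.
  - by rewrite acos_ge0 ?acos_lepi.
have pi0 := pi_gt0 R.
pose s := (al + be) / 2; pose t := (al - be) / 2.
have xE : x = cos (s + t).
  have -> : s + t = al by rewrite /s /t; field.
  by rewrite acosK// in_itv.
have yE : y = cos (s - t).
  have -> : s - t = be by rewrite /s /t; field.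
  by rewrite acosK// in_itv.
have xyE : x + y = 2 * (cos s * cos t) by rewrite xE yE cosD cosB; ring.
have cs0 : 0 <= cos s by apply: cos_ge0_pihalf; rewrite /s; lra.
have ct0 : 0 <= cos t by apply: cos_ge0_pihalf; rewrite /t; lra.
have dt : d <= 2 * cos t.
  have ct2 : 0 <= 2 * cos t by rewrite mulr_ge0.
  rewrite -(@ler_pXn2r _ 2)// ?nnegrE ?(ltW d0)//.
  apply: (le_trans dxy); rewrite -!sin_acos// -/al -/be.
  have -> : x * y + sin al * sin be = cos (t + t).
    have -> : t + t = al - be by rewrite /t; field.
    by rewrite cosB !acosK// in_itv.
  by rewrite cosD; have := cos2Dsin2 t; rewrite !expr2 => H; nra.
have csd : cos s <= (x + y) / d by rewrite ler_pdivlMr// xyE; nra.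
have xyd1 : (x + y) / d <= 1 by rewrite ler_pdivrMr// mul1r.
have xyd0 : 0 <= (x + y) / d by rewrite divr_ge0//; lra.
rewrite !profileE//; last by lra.
(* The value of [g] at the mean angle [s] separates the two sides: convexity bounds it by the mean
   of the values, and [csd] says that the angle with cosine [(x + y) / d] is at most [s]. *)
apply: (@le_trans _ _ (g s)); last first.
  have := @gconv al be (2^-1) _ _ _; rewrite !in_itv/= => /(_ al0 be0 _).
  have -> : 2^-1 * al + (1 - 2^-1) * be = s by rewrite /s; field.
  move=> H; apply: (le_trans (H _)); first lra.
  by rewrite -/al -/be; lra.
apply: g_le; rewrite ?in_itv/= ?acos_ge0 ?acos_lepi/=; try lra.
  by rewrite /s; lra.
rewrite leNgt -ltr_cos ?in_itv/= ?acos_ge0 ?acos_lepi/=; try lra.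
  by rewrite -leNgt acosK// in_itv/=; lra.
by rewrite /s; lra.
Qed.

End profile.

(** * Convex cones *)

Section convex_cones.
Context {R : realType} {n : nat}.
Implicit Types (x y z w v p q : 'rV[R]_n) (U : set 'rV[R]_n).

Lemma cvg_shift z v : z + t *: v @[t --> (0 : R)^'+] --> z.
Proof.
rewrite -[X in _ --> X]addr0; apply: cvgD; first exact: cvg_cst.
rewrite -[X in _ --> X](scale0r v); apply: cvgZr_tmp.
exact: cvg_at_right_filter.
Qed.

Lemma open_shift U z v : open U -> U z -> \forall t \near (0 : R)^'+, U (z + t *: v).
Proof. by move=> oU Uz; apply: cvg_shift; exact: open_nbhs_nbhs. Qed.

Lemma near_right0_ex (P Q : R -> Prop) : (\forall t \near (0 : R)^'+, P t) ->
  (\forall t \near (0 : R)^'+, Q t) -> exists t, P t /\ Q t.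
Proof.
move=> HP HQ.
exact: (@filter_ex _ ((0 : R)^'+) _ _ (@filterI _ ((0 : R)^'+) _ _ _ HP HQ)).
Qed.

Variable K : set 'rV[R]_n.
Hypothesis convK : convex_cone K.

Lemma coneD x y : K x -> K y -> K (x + y).
Proof. by move=> Kx Ky; rewrite -[x]scale1r -[y]scale1r; apply: convK. Qed.

Lemma coneZ a x : 0 <= a -> K x -> K (a *: x).
Proof. by move=> a0 Kx; rewrite -[_ *: _]addr0 -(scale0r x); apply: convK. Qed.

(** A point [y] close to [x + z] is the sum of [x] and [y - x], and the latter is close to [z],
    hence in [K]. *)
Lemma interior_coneD x z : K x -> interior K z -> interior K (x + z).
Proof.
move=> Kx Kz; change (nbhs (x + z) K).
have aux (F : set_system 'rV[R]_n) : Filter F -> F --> x + z -> y - x @[y --> F] --> z.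
  move=> FF Fxz; rewrite -[X in _ --> X](addKr x) addrC.
  by apply: cvgB => //; exact: cvg_cst.
have := aux _ (nbhs_filter (x + z)) cvg_id _ Kz.
apply: (@filterS _ _ (nbhs_filter (x + z))) => y /= Kyx.
by rewrite -(subrK x y); exact: coneD.
Qed.

Lemma interior_coneZ a z : 0 < a -> interior K z -> interior K (a *: z).
Proof.
move=> a0 Kz; change (nbhs (a *: z) K).
have aux (F : set_system 'rV[R]_n) : Filter F -> F --> a *: z ->
    a^-1 *: y @[y --> F] --> z.
  move=> FF Faz; have -> : z = a^-1 *: (a *: z).
    by rewrite scalerA mulVf ?scale1r// gt_eqF.
  exact: cvgZl_tmp.
have := aux _ (nbhs_filter (a *: z)) cvg_id _ Kz.
apply: (@filterS _ _ (nbhs_filter (a *: z))) => y /= Ky.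
have -> : y = a *: (a^-1 *: y) by rewrite scalerA mulfV ?scale1r// gt_eqF.
by apply: coneZ => //; exact: ltW.
Qed.

Lemma interior_normalize z : z != 0 -> interior K z -> interior K (normalize z).
Proof.
by move=> z0; apply: interior_coneZ; rewrite invr_gt0 sqrtr_gt0 dotvv_gt0.
Qed.

(** A short step from [z] along [- v] stays in [K] and strictly lowers the inner product with [v],
    which remains nonnegative. *)
Lemma interior_dual_gt0 v z : v != 0 -> dual_cone K v -> interior K z -> 0 < dotv v z.
Proof.
move=> v0 Kv Kz.
have [t [Kt t0]] : exists t : R, interior K (z + t *: (- v)) /\ 0 < t.
  apply: (@filter_ex _ (0 : R)^'+); apply: filterI; last exact: nbhs_right_gt.
  by apply: open_shift => //; exact: open_interior.
have := Kv _ (interior_subset Kt); rewrite !dotvE.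
by have : 0 < dotv v v by [rewrite dotvv_gt0]; nra.
Qed.

(** Take [v = p - w] with [p] the point of [K] nearest to [w]. Comparing [p] with [p + t *: y] puts
    [v] in the dual cone, and comparing it with [(1 - t) *: p] gives [dotv v p <= 0]; then
    [dotv v w = dotv v p - dotv v v] is negative. *)
Lemma cone_separation w : closed K -> K !=set0 -> ~ K w ->
  exists v, dual_cone K v /\ dotv v w < 0.
Proof.
move=> clK [x0 Kx0] nKw.
have K0 : K 0 by rewrite -(scale0r x0); exact: coneZ.
pose q x := dotv (x - w) (x - w).
have cq : continuous q.
  move=> x; have aux (F : set_system 'rV[R]_n) : Filter F -> F --> x ->
      q y @[y --> F] --> q x.
    by move=> FF Fx; apply: cvg_dotv => //; apply: cvgB => //; exact: cvg_cst.
  exact: (aux (nbhs x) _ cvg_id).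
pose A := K `&` [set x | q x <= q 0].
have A0 : A !=set0 by exists 0; split => /=.
have cA : compact A.
  apply: bounded_closed_compact.
    (* A point no farther from [w] than the origin satisfies [dotv x x <= 4 * dotv w w]; the added 1
       makes the bound at most its own square. *)
    exists (4 * dotv w w + 1); split; first exact: num_real.
    move=> c c1 x [_ /=]; rewrite /q !dotvE => H.
    have ww := dotvv_ge0 w.
    have := dotvv_ge0 (x - 2 *: w); rewrite !dotvE => H2.
    apply: mx_norm_le_dotv; first lra.
    have w0 : dotv 0 w = 0 by rewrite -(scale0r w) dotvZl mul0r.
    have w0' : dotv 0 (0 : 'rV[R]_n) = 0 by rewrite -(scale0r w) dotvZl mul0r.
    rewrite (dotvC w x) ?(dotvC w 0) ?w0 ?w0' in H H2.
    by apply: (@le_trans _ _ (4 * dotv w w)); [lra|nra].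
  apply: closedI => //.
  by apply: (@closed_comp _ _ q [set t | t <= q 0]);
    [move=> x _; exact: cq|exact: closed_le].
have [p] := EVT_min_rV A0 cA (continuous_subspaceT cq).
rewrite inE => -[Kp /= qp] minp.
have qmin x : K x -> q p <= q x.
  move=> Kx; have [qx|/ltW qx] := leP (q x) (q 0); last exact: le_trans qx.
  by apply: minp; rewrite inE.
have [v vE] : exists v, v = p - w by exists (p - w).
exists v.
have vv : 0 < dotv v v.
  by rewrite vE dotvv_gt0 subr_eq0; apply/eqP => pw; apply: nKw; rewrite -pw.
have qE x : q (p + x) = q p + 2 * dotv v x + dotv x x.
  by rewrite /q vE !dotvE (dotvC w p) (dotvC x p) (dotvC x w); ring.
have vp : dotv v p <= 0.
  rewrite leNgt; apply/negP => a0; set a := dotv v p in a0.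
  have pp := dotvv_ge0 p; set s := dotv p p in pp.
  (* The squared distance changes by [t ^+ 2 * s - 2 * t * a], which is least at [a / s]; the larger
     denominator is positive and keeps [t <= 1]. *)
  pose t := a / (s + a).
  have sa : 0 < s + a by lra.
  have t0 : 0 < t by rewrite divr_gt0.
  have ts : t * (s + a) = a by rewrite /t divfK// gt_eqF.
  have t1 : t <= 1 by rewrite ler_pdivrMr//; lra.
  have : K ((1 - t) *: p) by apply: coneZ => //; lra.
  have ta : 0 < t * a by rewrite mulr_gt0.
  have tta : 0 < t * (t * a) by rewrite mulr_gt0.
  have tts : t * (t * s) = t * a - t * (t * a) by rewrite -[X in t * X - _]ts; ring.
  by move/qmin; rewrite scalerBl scale1r -scaleNr qE !dotvE -/a -/s; lra.
split.
  move=> y Ky; rewrite leNgt; apply/negP => a0; set a := dotv v y in a0.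
  have yy := dotvv_ge0 y; set s := dotv y y in yy.
  (* The change is now [2 * t * a + t ^+ 2 * s], least at [- a / s]; the added 1 keeps the
     denominator positive. *)
  pose t := - a / (s + 1).
  have s1 : 0 < s + 1 by lra.
  have t0 : 0 < t by rewrite divr_gt0//; lra.
  have ts : t * (s + 1) = - a by rewrite /t divfK// gt_eqF.
  have : K (p + t *: y) by apply: coneD => //; apply: coneZ => //; exact: ltW.
  have ta : t * a < 0 by rewrite pmulr_rlt0.
  have tt : 0 < t * t by rewrite mulr_gt0.
  have tts : t * (t * s) = - (t * a) - t * t by rewrite -mulrN -ts; ring.
  by move/qmin; rewrite qE !dotvE -/a -/s; lra.
have -> : w = p - v by rewrite vE opprB addrC subrK.
by rewrite dotvDr dotvNr; lra.
Qed.

End convex_cones.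

(** * Decreasing the spherical mean *)

Section spherical_mean.
Context {R : realType} {n : nat}.
Implicit Types (x y z w v p q a b : 'rV[R]_n) (U : set 'rV[R]_n).
Variables (sigma : probability (Rn_borel R n) R) (K : set 'rV[R]_n) (g : R -> R).
Hypothesis usigma : uniform_sphere_measure sigma.
Hypothesis closedK : closed K.
Hypothesis convK : convex_cone K.
Hypothesis properK : proper_cone K.
Hypothesis intK : interior K !=set0.
Hypothesis gcont : {within `[0, pi], continuous g}.
Hypothesis ginc : {in `[0, pi] &, forall x y : R, x < y -> g x < g y}.
Hypothesis gconv : forall x y t : R, x \in `[0, pi / 2] -> y \in `[0, pi / 2] ->
  t \in `[0, 1] -> g (t * x + (1 - t) * y) <= t * g x + (1 - t) * g y.

Local Notation S := (sphere R n : set (Rn_borel R n)).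
Local Notation h := (profile g).

Let mS : measurable S.
Proof. exact: (closed_Rn_measurable (@closed_sphere R n)). Qed.

(** The domain is the whole sphere, with [K] in the integrand, because reflections preserve the
    sphere but not [K]. *)
Definition psiR w : R := \int[sigma]_(y in S) (\1_K y * h (dotv w y)).

Lemma bounded_measurable_profile w : bounded_measurable (fun y => h (dotv w y)).
Proof.
split; last by have [M hM] := profile_bounded ginc; exists M.
apply: continuous_Rn_measurable => y.
apply: (@continuous_comp _ _ _ (dotv w) h); first exact: dotvl_continuous.
exact: profile_continuous.
Qed.

Let bmK : bounded_measurable \1_K. Proof. exact: bounded_measurable_indic. Qed.

Let bm_psiR w : bounded_measurable (fun y => \1_K y * h (dotv w y)).
Proof. by apply: bounded_measurableM => //; exact: bounded_measurable_profile. Qed.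

Lemma psiE w : sphere R n w -> psi sigma K g w = (psiR w)%:E.
Proof.
move=> sw; rewrite /psiR /Rintegral fineK; last first.
  by apply: integrable_fin_num => //; exact: bounded_measurable_integrable.
rewrite /psi /sph_part setIC integral_mkcondr; apply: eq_integral => y.
rewrite inE => sy; rewrite /patch indicE; case: ifPn => _; last by rewrite mul0r.
by rewrite mul1r profileE//; exact: dotv_sphere_bound.
Qed.

Lemma psiRB a b : psiR a - psiR b =
  \int[sigma]_(y in S) (\1_K y * (h (dotv a y) - h (dotv b y))).
Proof.
rewrite /psiR -RintegralB//; try exact: bounded_measurable_integrable.
by apply: eq_Rintegral => y _; rewrite mulrBr.
Qed.

(** By compactness of the sphere, the integrand depends on [w] continuously, uniformly in [y], and
    [sigma] has total mass 1. *)
Lemma psiR_continuous : continuous psiR.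
Proof.
move=> w; apply/(@cvgrPdist_le _ _ _ _ (nbhs_filter w)) => e e0.
have near_h : \forall w' \near w, forall y, sphere R n y ->
    `|h (dotv w y) - h (dotv w' y)| <= e.
  have /compact_near_coveringP cov := @compact_sphere R n.
  apply: (cov _ (nbhs w) (fun w' y => `|h (dotv w y) - h (dotv w' y)| <= e)
    (nbhs_filter w)) => y _.
  have ch (T : Type) (F : set_system T) (f k : T -> 'rV[R]_n) :
      Filter F -> f @ F --> w -> k @ F --> y ->
      h (dotv (f t) (k t)) @[t --> F] --> h (dotv w y).
    move=> FF fw ky; apply: (cvg_comp _ _ (cvg_dotv FF fw ky)).
    exact: profile_continuous.
  have c0 (T : Type) (F : set_system T) (f k : T -> 'rV[R]_n) :
      Filter F -> f @ F --> w -> k @ F --> y ->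
      h (dotv w (k t)) - h (dotv (f t) (k t)) @[t --> F] --> (0 : R).
    move=> FF fw ky; rewrite -(subrr (h (dotv w y))); apply: cvgB.
      by apply: ch => //; exact: cvg_cst.
    exact: ch.
  have Fy := nbhs_filter y; have Fw := nbhs_filter w.
  have /cvgr0Pnorm_le /(_ _ e0) := c0 _ _ snd fst
    (@filter_prod_filter _ _ (nbhs y) (nbhs w) Fy Fw)
    (@cvg_snd _ _ (nbhs y) (nbhs w) Fy) (@cvg_fst _ _ (nbhs y) (nbhs w) Fw).
  exact.
apply: (@filterS _ _ (nbhs_filter w) _ _ _ near_h) => w' hw'; rewrite psiRB.
apply: (le_trans (le_normr_Rintegral _ _)) => //.
  apply: bounded_measurable_integrable.
  by apply: bounded_measurableM => //; apply: bounded_measurableB;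
    exact: bounded_measurable_profile.
apply: (@le_trans _ _ (\int[sigma]_(y in S) (cst e y))).
  apply: le_Rintegral => //.
  - apply: integrable_norm; apply: bounded_measurable_integrable.
    by apply: bounded_measurableM => //; apply: bounded_measurableB;
      exact: bounded_measurable_profile.
  - apply: bounded_measurable_integrable; split; first exact: measurable_cst.
    by exists `|e|.
  - move=> y sy; rewrite normrM indicE.
    case: (_ \in _); rewrite ?normr0 ?mul0r ?(ltW e0)//.
    by rewrite normr1 mul1r; exact: hw'.
rewrite Rintegral_cst// ler_piMr ?(ltW e0)//.
rewrite -lee_fin fineK; first exact: probability_le1.
exact: fin_num_measure.
Qed.

Lemma Rintegral_cone_gt0 f U p : bounded_measurable f ->
  (forall y, sphere R n y -> K y -> 0 <= f y) ->
  open U -> U `<=` K -> U p -> sphere R n p ->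
  (forall y, sphere R n y -> U y -> 0 < f y) ->
  0 < \int[sigma]_(y in S) (\1_K y * f y).
Proof.
move=> bf f0 oU UK Up sp fU; apply: (Rintegral_sphere_gt0 usigma _ _ oU Up sp).
- exact: bounded_measurableM.
- move=> y sy; rewrite indicE; have [/set_mem Ky|_] := boolP (y \in K).
    by rewrite mul1r f0.
  by rewrite mul0r.
- move=> y sy Uy; rewrite indicE mem_set; last exact: UK.
  by rewrite mul1r fU.
Qed.

Lemma interior_neq0 z : interior K z -> z != 0.
Proof.
move=> Kz; have [v [v0 Kv]] := properK; apply/eqP => z0.
have : 0 < dotv v z.
  by apply: (interior_dual_gt0 v0 _ Kz) => x /Kv; rewrite dotvC.
by rewrite z0 -(scale0r v) dotvZr mul0r ltxx.
Qed.

Lemma interior_oppN z : interior K z -> ~ K (- z).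
Proof.
move=> Kz KNz; have [v [v0 Kv]] := properK.
have : 0 < dotv v z.
  by apply: (interior_dual_gt0 v0 _ Kz) => x /Kv; rewrite dotvC.
by have := Kv _ KNz; rewrite dotvNl dotvC; lra.
Qed.

(* Folding along the mirror of [z] moves the part of [K] behind the mirror into
   [K], since [K] is stable by adding multiples of [z]; what is left of [K]
   is closer to the image of [w] than to [w]. *)
Lemma psiR_reflectv_lt w z : sphere R n w -> interior K z -> dotv w z < 0 ->
  psiR (reflectv z w) < psiR w.
Proof.
move=> sw Kz wz; have z0 := interior_neq0 Kz.
have zz : 0 < dotv z z by rewrite dotvv_gt0.
set w' := reflectv z w; have sw' : sphere R n w' by apply/reflectv_sphere.
pose D y := h (dotv w y) - h (dotv w' y).
have bD : bounded_measurable D.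
  by apply: bounded_measurableB; exact: bounded_measurable_profile.
have DN y : D (reflectv z y) = - D y.
  by rewrite /D /w' !reflectv_adj reflectvK -reflectv_adj opprB.
pose c := - 2 * dotv w z / dotv z z.
have c0 : 0 < c by rewrite /c divr_gt0//; lra.
have w'E y : dotv w' y = dotv w y + c * dotv z y.
  by rewrite /w' /reflectv /c !dotvE; ring.
(* As [D] is odd under the reflection, the change of variables turns the integral of the second term
   into the opposite of that of the first, so [J] integrates to twice the decrease. *)
pose J y := \1_K y * D y - \1_K (reflectv z y) * D y.
have bKD : bounded_measurable (fun y => \1_K y * D y) by exact: bounded_measurableM.
have bKD' : bounded_measurable (fun y => \1_K (reflectv z y) * D y).
  by apply: bounded_measurableM => //; exact: (bounded_measurable_reflectv z bmK).
have IJ : \int[sigma]_(y in S) J y = 2 * (psiR w - psiR w').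
  rewrite RintegralB//; try exact: bounded_measurable_integrable.
  rewrite psiRB -/D; set I := Rintegral _ _ _.
  suff -> : \int[sigma]_(y in S) (\1_K (reflectv z y) * D y) = - I by ring.
  rewrite /I -(Rintegral_reflectv usigma z bKD) -[in RHS]mulN1r -RintegralZl//.
    by apply: eq_Rintegral => y _; rewrite DN; ring.
  by apply: bounded_measurable_integrable; exact: (bounded_measurable_reflectv z bKD).
suff : 0 < \int[sigma]_(y in S) J y by rewrite IJ; lra.
have reflKE y : y = reflectv z y + (2 * dotv z y / dotv z z) *: z.
  by rewrite /reflectv (dotvC z y) subrK.
(* On [U] both factors of [J] are positive. It contains the direction of [z], whose mirror image is
   its opposite and lies outside [K]. *)
pose U := interior K `&` (dotv z @^-1` [set t | 0 < t]) `&`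
  (reflectv z @^-1` (~` K)).
apply: (@Rintegral_sphere_gt0 _ _ _ usigma J U (normalize z)).
- exact: bounded_measurableB.
- move=> y sy; rewrite /J -mulrBl.
  have [zy|zy] := leP 0 (dotv z y).
    apply: mulr_ge0.
      rewrite subr_ge0 !indicE ler_nat.
      have [/set_mem Ksy|//] := boolP (reflectv z y \in K).
      rewrite mem_set//; rewrite (reflKE y); apply: (coneD convK) => //.
      apply: (coneZ convK); last exact: interior_subset.
      by rewrite divr_ge0 ?mulr_ge0// ltW.
    by rewrite subr_ge0; apply: (profile_le ginc); rewrite w'E lerDl; nra.
  apply: mulr_le0.
    rewrite subr_le0 !indicE ler_nat.
    have [/set_mem Ky|//] := boolP (y \in K).
    rewrite mem_set//; rewrite /reflectv -scaleNr; apply: (coneD convK) => //.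
    apply: (coneZ convK); last exact: interior_subset.
    by rewrite dotvC oppr_ge0 pmulr_lle0 ?invr_gt0//; lra.
  by rewrite subr_le0; apply: (profile_le ginc); rewrite w'E gerDl; nra.
- apply: openI; last first.
    by move/continuousP: (@reflectv_continuous R n z); apply; exact: closed_openC.
  apply: openI; first exact: open_interior.
  by move/continuousP: (@dotvl_continuous R n z); apply; exact: open_gt.
- have r0 : 0 < (Num.sqrt (dotv z z))^-1 by rewrite invr_gt0 sqrtr_gt0.
  split; first split.
  + exact: interior_normalize.
  + by rewrite /= /normalize dotvZr mulr_gt0.
  + rewrite /= => Kr; apply: (interior_oppN (interior_normalize convK z0 Kz)).
    suff <- : reflectv z (normalize z) = - normalize z by [].
    rewrite /reflectv /normalize dotvZl mulrA mulfK ?gt_eqF//.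
    by rewrite -scalerA scaler_nat mulr2n opprD addrA subrr sub0r.
- exact: normalize_sphere.
- move=> y sy [[Ky zy] nKsy].
  rewrite /J !indicE mem_set ?memNset//; last exact: interior_subset.
  rewrite mul1r mul0r subr0 subr_gt0; apply: (profile_lt ginc).
  + by have /andP[] := dotv_sphere_bound sw sy.
  + by have /andP[] := dotv_sphere_bound sw' sy.
  + by rewrite w'E ltrDl mulr_gt0.
Qed.

(** * Local and global minimum points *)

Definition psiR_local_min w :=
  \forall v \near w, sphere R n v -> psiR w <= psiR v.

Lemma psiR_local_min_cvg w (f : R -> 'rV[R]_n) : psiR_local_min w ->
  f t @[t --> (0 : R)^'+] --> w ->
  ~ (\forall t \near (0 : R)^'+, sphere R n (f t) /\ psiR (f t) < psiR w).
Proof.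
move=> wmin fw flt.
have fmin : \forall t \near (0 : R)^'+, sphere R n (f t) -> psiR w <= psiR (f t).
  exact: fw _ wmin.
have [t [/= h1 [h2 h3]]] := near_right0_ex fmin flt.
by have := h1 h2; rewrite leNgt h3.
Qed.

(** If [w] had inner products of both signs with [K], some interior point of [K] would be orthogonal
    to [w], and tilting it slightly away from [w] would give reflections that move [w] arbitrarily
    little and decrease [psiR]. *)
Lemma local_min_dual w : sphere R n w -> ~ dual_cone K (- w) ->
  psiR_local_min w -> dual_cone K w.
Proof.
move=> sw nw wmin y1 Ky1; rewrite leNgt; apply/negP => wy1.
have [y2 [Ky2 wy2]] : exists y2, K y2 /\ 0 < dotv w y2.
  apply: contrapT => H; apply: nw => v Kv; rewrite dotvNl oppr_ge0 leNgt.
  by apply/negP => wv; apply: H; exists v.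
have [z Kz] := intK.
(* The factor [s] is used with the values 1 and -1, to treat both signs of the inner product at
   once. *)
have op (s : R) : open (dotv w @^-1` [set t | s * t < 0]).
  have cs : continuous (fun y => s * dotv w y).
    move=> x; apply: (@continuous_comp _ _ _ (dotv w) (fun t => s * t)).
      exact: dotvl_continuous.
    by move=> t; apply: cvgMl_tmp; exact: cvg_id.
  by move/continuousP: cs => /(_ [set t | t < 0]); apply; exact: open_lt.
have shift (s : R) y : K y -> s * dotv w y < 0 ->
    exists u, interior K u /\ s * dotv w u < 0.
  move=> Ky wy; have H := @open_shift R n _ y z (op s) wy.
  have [t [/= wt t0]] := near_right0_ex H (nbhs_right_gt (0 : R)).
  exists (y + t *: z); split=> //; apply: (interior_coneD convK) => //.
  exact: interior_coneZ.
have [u1 [Ku1 wu1]] : exists u, interior K u /\ 1 * dotv w u < 0.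
  by apply: (shift 1 y1) => //; rewrite mul1r.
have [u2 [Ku2 wu2]] : exists u, interior K u /\ -1 * dotv w u < 0.
  by apply: (shift (-1) y2) => //; lra.
(* Both coefficients are positive, and they cancel the inner product with [w]. *)
pose z0 := dotv w u2 *: u1 + (- dotv w u1) *: u2.
have Kz0 : interior K z0.
  apply: (interior_coneD convK).
    by apply: (coneZ convK); [lra|exact: interior_subset].
  by apply: (interior_coneZ convK) => //; lra.
have wz0 : dotv w z0 = 0 by rewrite /z0 !dotvE; ring.
apply: (@psiR_local_min_cvg w (fun t => reflectv (z0 + t *: (- w)) w)) => //.
  apply: cvg_reflectv0 wz0 _; first exact: interior_neq0.
  exact: cvg_shift.
have Kt := @open_shift R n _ z0 (- w) (@open_interior _ K) Kz0.
apply: filterS (filterI Kt (nbhs_right_gt (0 : R))) => t [/= Kzt t0].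
split; first exact/reflectv_sphere.
apply: psiR_reflectv_lt => //.
by rewrite dotvDr wz0 dotvZr dotvNr sw; lra.
Qed.

Lemma local_min_cone w : sphere R n w -> dual_cone K w ->
  psiR_local_min w -> K w.
Proof.
move=> sw Kw wmin; apply: contrapT => nKw.
have [z Kz] := intK.
have K0 : K !=set0 by exists z; exact: interior_subset.
have [v [Kv vw]] := cone_separation convK closedK K0 nKw.
have v0 : v != 0.
  by apply/eqP => v0; move: vw; rewrite v0 -(scale0r w) dotvZl mul0r ltxx.
apply: (@psiR_local_min_cvg w (fun t => normalize (w + t *: v))) => //.
  by apply: cvg_normalize => //; exact: cvg_shift.
have cN : dotv (w + t *: v) (w + t *: v) @[t --> (0 : R)^'+] --> dotv w w.
  by apply: cvg_dotv; exact: cvg_shift.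
have Npos : \forall t \near (0 : R)^'+, 0 < dotv (w + t *: v) (w + t *: v).
  have : nbhs (dotv w w) [set t : R | 0 < t].
    by apply: open_nbhs_nbhs; split; [exact: open_gt|rewrite /= sw].
  by move=> /(cN _).
near=> t.
have t0 : 0 < t by [].
have Nt : 0 < dotv (w + t *: v) (w + t *: v) by near: t.
(* The squared length is [1 + 2 * t * dotv v w + t ^+ 2 * dotv v v] with [dotv v w < 0]. As it is at
   most 1, normalizing can only increase nonnegative inner products. *)
have N1 : dotv (w + t *: v) (w + t *: v) <= 1.
  have tv : t * dotv v v <= - 2 * dotv v w.
    rewrite -ler_pdivlMr ?dotvv_gt0//; near: t.
    by apply: nbhs_right_le; rewrite divr_gt0 ?dotvv_gt0//; lra.
  by rewrite !dotvE sw (dotvC w v); nra.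
have st : sphere R n (normalize (w + t *: v)).
  by apply: normalize_sphere; rewrite -dotvv_gt0.
split=> //; rewrite -subr_gt0 psiRB.
have ge y : K y -> dotv w y + t * dotv v y <= dotv (normalize (w + t *: v)) y.
  move=> Ky; rewrite /normalize dotvZl [leRHS]mulrC ler_pdivlMr ?sqrtr_gt0//.
  rewrite [leRHS]dotvDl dotvZl ler_piMr//.
    by have := Kw _ Ky; have := Kv _ Ky; nra.
  by rewrite -[leRHS]sqrtr1 ler_wsqrtr.
have z0 := interior_neq0 Kz.
apply: (@Rintegral_cone_gt0 _ (interior K) (normalize z)).
- by apply: bounded_measurableB; exact: bounded_measurable_profile.
- move=> y sy Ky; rewrite subr_ge0; apply: (profile_le ginc).
  by apply: le_trans (ge _ Ky); rewrite lerDl mulr_ge0 ?Kv// ltW.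
- exact: open_interior.
- exact: interior_subset.
- exact: interior_normalize.
- exact: normalize_sphere.
- move=> y sy Ky; rewrite subr_gt0; apply: (profile_lt ginc).
  + by have /andP[] := dotv_sphere_bound sw sy.
  + by have /andP[] := dotv_sphere_bound st sy.
  + apply: lt_le_trans (ge _ (interior_subset Ky)).
    by rewrite ltrDl mulr_gt0//; exact: (interior_dual_gt0 v0 Kv Ky).
Unshelve. all: by end_near. Qed.

(** The last conjunct makes repeated halving converge to [a]. With [c = dotv a b] and [d] the length
    of [a + b], it reads [1 + c <= d], true because [d ^+ 2 = 2 + 2 * c] and [0 <= c <= 1]. *)
Lemma psiR_midpoint a b : sphere R n a -> sphere R n b ->
  K a -> dual_cone K a -> K b -> dual_cone K b -> a != b ->
  exists m, [/\ sphere R n m, K m, dual_cone K m,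
    2 * psiR m < psiR a + psiR b &
    2 * (1 - dotv m a) <= 1 - dotv b a].
Proof.
move=> sa sb Ka Ka' Kb Kb' ab.
have c0 : 0 <= dotv a b by exact: Ka'.
have c1 : dotv a b < 1.
  by rewrite ltNge; apply/negP => /(sphere_inj sa sb)/eqP; exact/negP.
pose d := Num.sqrt (dotv (a + b) (a + b)).
have dd : dotv (a + b) (a + b) = 2 + 2 * dotv a b.
  by rewrite !dotvE sa sb (dotvC b a); ring.
have d2 : d ^+ 2 = 2 + 2 * dotv a b by rewrite sqr_sqrtr dd//; lra.
have d0 : 0 < d by rewrite sqrtr_gt0 dd; lra.
have dlt2 : d < 2 by rewrite ltNge; apply/negP => d2le; nra.
have mE y : dotv (normalize (a + b)) y = (dotv a y + dotv b y) / d.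
  by rewrite /normalize -/d !dotvE mulrC.
pose m := normalize (a + b).
have sm : sphere R n m by apply: normalize_sphere; rewrite -dotvv_gt0 dd; lra.
have Km : K m.
  by apply: (coneZ convK); [rewrite invr_ge0 ltW|exact: coneD].
have Km' : dual_cone K m.
  by move=> y Ky; rewrite mE divr_ge0 ?addr_ge0 ?Ka' ?Kb'// ltW.
have ma : dotv m a = d / 2.
  rewrite mE sa (dotvC b a); apply: (mulIf (lt0r_neq0 d0)).
  by rewrite divfK ?gt_eqF//; have := d2; rewrite expr2; lra.
have mb : dotv m b = d / 2.
  rewrite mE sb; apply: (mulIf (lt0r_neq0 d0)).
  by rewrite divfK ?gt_eqF//; have := d2; rewrite expr2; lra.
exists m; split=> //; last first.
  have : 1 + dotv a b <= d.
    by rewrite leNgt; apply/negP => dl; nra.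
  by rewrite ma (dotvC b a); lra.
pose f y := (h (dotv a y) - h (dotv m y)) - (h (dotv m y) - h (dotv b y)).
have bmf : bounded_measurable f.
  by apply: bounded_measurableB; apply: bounded_measurableB;
    exact: bounded_measurable_profile.
have If : \int[sigma]_(y in S) (\1_K y * f y) = psiR a + psiR b - 2 * psiR m.
  have -> : psiR a + psiR b - 2 * psiR m = (psiR a - psiR m) - (psiR m - psiR b) by ring.
  rewrite !psiRB -RintegralB//.
  - by apply: eq_Rintegral => y _; rewrite -mulrBr.
  - apply: bounded_measurable_integrable; apply: bounded_measurableM => //.
    by apply: bounded_measurableB; exact: bounded_measurable_profile.
  - apply: bounded_measurable_integrable; apply: bounded_measurableM => //.
    by apply: bounded_measurableB; exact: bounded_measurable_profile.
rewrite -subr_gt0 -If.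
have hc x : continuous (fun y => h (dotv x y)).
  move=> y; apply: (@continuous_comp _ _ _ (dotv x) h).
    exact: dotvl_continuous.
  exact: profile_continuous.
have fc : continuous f.
  by move=> y; apply: (@cvgB _ _ _ _ (nbhs_filter y));
    apply: (@cvgB _ _ _ _ (nbhs_filter y)); exact: hc.
have oU : open (interior K `&` f @^-1` [set t | 0 < t]).
  apply: openI; first exact: open_interior.
  by move/continuousP: fc; apply; exact: open_gt.
have fm : 0 < f m.
  rewrite /f (dotvC a) (dotvC b) ma mb sm.
  have : h 1 < h (d / 2) by apply: (profile_lt ginc); lra.
  lra.
have [z Kz] := intK.
(* The midpoint [m] may lie on the boundary of [K]; a small push along [z] enters the interior and
   keeps [f] positive. *)
have [p [sp [Kp fp]]] : exists p, sphere R n p /\ interior K p /\ 0 < f p.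
  have cp : normalize (m + t *: z) @[t --> (0 : R)^'+] --> m.
    by apply: cvg_normalize => //; exact: cvg_shift.
  have fpos : nbhs m (f @^-1` [set t | 0 < t]).
    apply: open_nbhs_nbhs; split=> //.
    by move/continuousP: fc; apply; exact: open_gt.
  have fp : \forall t \near (0 : R)^'+, 0 < f (normalize (m + t *: z)).
    exact: cp _ fpos.
  have [t [/= ft t0]] := near_right0_ex fp (nbhs_right_gt (0 : R)).
  have Kt : interior K (m + t *: z).
    by apply: (interior_coneD convK) => //; exact: interior_coneZ.
  exists (normalize (m + t *: z)); split.
    by apply: normalize_sphere; exact: interior_neq0.
  by split=> //; apply: interior_normalize => //; exact: interior_neq0.
apply: (Rintegral_cone_gt0 bmf _ oU _ (conj Kp fp) sp) => [y sy Ky|y [Ky _]|y _ []//];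
  last exact: interior_subset.
have a01 : 0 <= dotv a y <= 1.
  by rewrite Ka'//; have /andP[] := dotv_sphere_bound sa sy.
have b01 : 0 <= dotv b y <= 1.
  by rewrite Kb'//; have /andP[] := dotv_sphere_bound sb sy.
have := @profile_midpoint R g ginc gconv (dotv a y) (dotv b y) d a01 b01 d0.
rewrite -mE -/m => H; rewrite /f.
suff : h (dotv m y) <= (h (dotv a y) + h (dotv b y)) / 2 by lra.
apply: H.
  (* The required bound on [d ^+ 2] is the Cauchy-Schwarz inequality for the components of [a] and
     [b] orthogonal to [y]. *)
  rewrite d2 lerD2l ler_pM2l// -lerBlDl.
  have a1 : 0 <= 1 - dotv a y ^+ 2 by nra.
  have b1 : 0 <= 1 - dotv b y ^+ 2 by nra.
  rewrite -sqrtrM//; apply: le_trans (ler_norm _) _.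
  rewrite -sqrtr_sqr ler_wsqrtr//.
  have := dotv_cauchy_schwarz (a - dotv a y *: y) (b - dotv b y *: y).
  rewrite !dotvE sa sb sy (dotvC y a) (dotvC y b).
  by congr (_ <= _); ring.
rewrite -[leRHS]mul1r -ler_pdivrMr// -mE.
by have /andP[] := dotv_sphere_bound sm sy.
Qed.

(** If the points differed, repeatedly taking the midpoint with [w], starting from [w0], would give
    points arbitrarily close to [w] with smaller [psiR]. *)
Lemma local_min_unique w w0 : sphere R n w -> sphere R n w0 ->
  K w -> dual_cone K w -> K w0 -> dual_cone K w0 ->
  psiR_local_min w -> psiR w0 <= psiR w -> w = w0.
Proof.
move=> sw sw0 Kw Kw' Kw0 Kw0' wmin w0w; apply/eqP; apply: contrapT => /negP ww0.
have halve b : sphere R n b -> K b -> dual_cone K b -> psiR b <= psiR w -> w != b ->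
    exists m, [/\ sphere R n m, K m, dual_cone K m, psiR m < psiR w &
      2 * (1 - dotv m w) <= 1 - dotv b w].
  move=> sb Kb Kb' bw wb.
  have [m [sm Km Km' mlt mw]] := psiR_midpoint sw sb Kw Kw' Kb Kb' wb.
  by exists m; split=> //; lra.
(* A harmonic rate suffices, and halving preserves it because [k + 2 <= 2 * k + 2]. *)
have small k : exists m, [/\ sphere R n m, K m, dual_cone K m, psiR m < psiR w &
    k.+1%:R * (1 - dotv m w) <= 1].
  elim: k => [|k [b [sb Kb Kb' bw kb]]].
    have [m [sm Km Km' mlt mw]] := halve _ sw0 Kw0 Kw0' w0w ww0.
    exists m; split=> //; have := Km' _ Kw; lra.
  have wb : w != b by apply/eqP => wb; move: bw; rewrite wb ltxx.
  have [m [sm Km Km' mlt mw]] := halve b sb Kb Kb' (ltW bw) wb.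
  exists m; split=> //; apply: le_trans kb.
  have m1 : dotv m w <= 1 by have /andP[] := dotv_sphere_bound sm sw.
  have := ler0n R k; rewrite -!natr1; nra.
have /nbhs_ballP[e /= e0 we] := wmin.
(* The squared distance from [m] to [w] is [2 * (1 - dotv m w)], at most [2 / k.+1%:R], hence below
   [(e / 2) ^+ 2]. *)
pose k := Num.truncn (8 / e ^+ 2).
have [m [sm Km Km' mlt mk]] := small k.
have : `|m - w| <= e / 2.
  apply: mx_norm_le_dotv; first by lra.
  have ke : 8 / e ^+ 2 < k.+1%:R by exact: truncnS_gt.
  have e2 : 0 < e ^+ 2 by rewrite exprn_gt0.
  rewrite ltr_pdivrMr// in ke.
  have m1 : dotv m w <= 1 by have /andP[] := dotv_sphere_bound sm sw.
  rewrite !dotvE sm sw (dotvC w m).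
  have k0 : (0 : R) < k.+1%:R by [].
  rewrite -(@ler_pM2l _ k.+1%:R)//.
  have -> : k.+1%:R * (e / 2) ^+ 2 = (k.+1%:R * e ^+ 2) / 4 by field.
  lra.
move=> mwe; suff : psiR w <= psiR m by rewrite leNgt mlt.
apply: we => //; rewrite -ball_normE /= distrC; lra.
Qed.

(** Otherwise [w] would have a negative inner product with an interior point of [K], and the
    corresponding reflection would decrease [psiR], however far it moves [w]. *)
Lemma global_min_not_opp_dual w : sphere R n w ->
  (forall v, sphere R n v -> psiR w <= psiR v) -> ~ dual_cone K (- w).
Proof.
move=> sw minw Kw; have [z Kz] := intK.
have Nw0 : - w != 0 by rewrite oppr_eq0 sphere_neq0.
have := interior_dual_gt0 Nw0 Kw Kz; rewrite dotvNl oppr_gt0.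
move=> /(psiR_reflectv_lt sw Kz); rewrite ltNge minw//.
exact/reflectv_sphere.
Qed.

Lemma psiR_global_min : exists w0, [/\ sphere R n w0,
  (forall w, sphere R n w -> psiR w0 <= psiR w),
  ~ dual_cone K (- w0), dual_cone K w0 & K w0].
Proof.
have [z Kz] := intK; have z0 := interior_neq0 Kz.
have S0 : sphere R n !=set0 by exists (normalize z); exact: normalize_sphere.
have [w0] := EVT_min_rV S0 (@compact_sphere R n) (continuous_subspaceT psiR_continuous).
rewrite inE => sw0 min0; exists w0.
have {}min0 w : sphere R n w -> psiR w0 <= psiR w.
  by move=> sw; apply: min0; rewrite inE.
have nw0 := global_min_not_opp_dual sw0 min0.
have lmin : psiR_local_min w0.
  by apply: (@nearW _ _ _ (nbhs_filter w0)) => v; exact: min0.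
have Kw0 := local_min_dual sw0 nw0 lmin.
by split=> //; exact: local_min_cone.
Qed.

End spherical_mean.

Theorem mainTheorem6 (R : realType) (n : nat)
  (sigma : probability (Rn_borel R n) R)
  (K : set 'rV[R]_n) (g : R -> R) :
  uniform_sphere_measure sigma ->
  closed K -> convex_cone K -> proper_cone K -> interior K !=set0 ->
  {within `[0, pi], continuous g} ->
  {in `[0, pi] &, forall x y, x < y -> g x < g y} ->
  (forall x y t, x \in `[0, pi / 2] -> y \in `[0, pi / 2] -> t \in `[0, 1] ->
     g (t * x + (1 - t) * y) <= t * g x + (1 - t) * g y) ->
  exists w0 : 'rV[R]_n,
    [/\ sphere R n w0,
        (forall w, sphere R n w -> (psi sigma K g w0 <= psi sigma K g w)%E),
        (forall w1, sphere R n w1 ->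
           (forall w, sphere R n w -> (psi sigma K g w1 <= psi sigma K g w)%E) ->
           w1 = w0),
        ~ dual_cone K (- w0)
      & (forall w, sphere R n w -> ~ dual_cone K (- w) ->
           (\forall v \near w, sphere R n v -> (psi sigma K g w <= psi sigma K g v)%E) ->
           w = w0)].
Proof.
move=> us cK vK pK iK gc gi gv.
have [w0 [sw0 min0 nw0 Kw0' Kw0]] := psiR_global_min us cK vK pK iK gc gi.
have leE u v : sphere R n u -> sphere R n v ->
    (psi sigma K g u <= psi sigma K g v)%E = (psiR sigma K g u <= psiR sigma K g v).
  by move=> su sv; rewrite !(psiE sigma cK gc gi)// lee_fin.
have uniq w : sphere R n w -> ~ dual_cone K (- w) ->
    psiR_local_min sigma K g w -> w = w0.
  move=> sw nw lw.
  have Kw' := local_min_dual us cK vK pK iK gc gi sw nw lw.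
  have Kw := local_min_cone us cK vK pK iK gc gi sw Kw' lw.
  by apply: (local_min_unique us cK vK pK iK gc gi gv) => //; exact: min0.
exists w0; split=> //.
- by move=> w sw; rewrite leE// min0.
- move=> w1 sw1 min1.
  have {}min1 w : sphere R n w -> psiR sigma K g w1 <= psiR sigma K g w.
    by move=> sw; rewrite -leE// min1.
  apply: uniq => //; last by apply: (@nearW _ _ _ (nbhs_filter w1)) => v; exact: min1.
  exact: (global_min_not_opp_dual us cK vK pK iK gc gi sw1 min1).
- move=> w sw nw lw; apply: uniq => //.
  by apply: (@filterS _ _ (nbhs_filter w) _ _ _ lw) => v H sv; rewrite -leE// H.
Qed.
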